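(* Let $f(x)=\frac1n\sum_{i=1}^n f_i(x)$ on $\mathbb{R}^d$ with each $f_i$ convex and $L$-smooth, and let $x_0$ satisfy $\|x_0-x^\star\|\le R_0$ for some minimizer $x^\star$ of $f$. Run the following algorithm (Acc-SVRG-G) for $K$ iterations with $p_k=\max\{\frac{6}{k+8},\frac1n\}$ and $\tau_k=\frac{3}{p_k(k+8)}$: set $z_0=\tilde x_0=x_0$, $\alpha_k=\frac{L\tau_k}{1-\tau_k}$, and for $k=0,\dots,K-1$: $y_k=\tau_kz_k+(1-\tau_k)(\tilde x_k-\frac1L\nabla f(\tilde x_k))$; $z_{k+1}=\arg\min_x\{\langle\mathcal G_k,x\rangle+\frac{\alpha_k}2\|x-z_k\|^2\}$ with $\mathcal G_k=\nabla f_{i_k}(y_k)-\nabla f_{i_k}(\tilde x_k)+\nabla f(\tilde x_k)$ and $i_k$ uniform on $\{1,\dots,n\}$; $\tilde x_{k+1}=y_k$ with probability $p_k$, else $\tilde x_{k+1}=\tilde x_k$. Let $x_{\rm out}$ be sampled from $\{\tilde x_0,\dots,\tilde x_{K-1}\}$ with $\Pr\{x_{\rm out}=\tilde x_k\}=\tau_k^{-2}/\sum_{j=0}^{K-1}\tau_j^{-2}$. Then the oracle complexities needed to guarantee $\mathbb E\|\nabla f(x_{\rm out})\|\le\epsilon_g$ and $\mathbb E[f(\tilde x_K)]-f(x^\star)\le\epsilon_f$ are $$O\!\left(n\min\Big\{\log\frac{LR_0}{\epsilon_g},\log n\Big\}+\frac{(nLR_0)^{2/3}}{\epsilon_g^{2/3}}\right)\quad\text{and}\quad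 O\!\left(n\min\Big\{\log\frac{LR_0^2}{\epsilon_f},\log n\Big\}+\frac{\sqrt{nL}R_0}{\sqrt{\epsilon_f}}\right),$$ respectively.
   Context: $L$-smooth means $L$-Lipschitz gradient. Oracle complexity is the expected number of component gradient evaluations $\nabla f_i$; a full gradient $\nabla f$ costs $n$ such evaluations and is recomputed only when $\tilde x$ changes.
   Formalization: The factor min{log(·), log n} is replaced by max{1, min{log(·), log n}} in both bounds, since otherwise the bound can fall below the cost n of one full gradient, or be negative, when ε_g is near or above LR_0 (or ε_f above LR_0²). *)

(* Defs.v *)
From HB Require Import structures.
From mathcomp Require Import all_boot all_order all_algebra.
From mathcomp Require Import all_classical all_reals all_analysis.
Import Order.TTheory GRing.Theory Num.Theory.
Import numFieldNormedType.Exports.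
Set Implicit Arguments.
Unset Strict Implicit.
Unset Printing Implicit Defensive.
Local Open Scope ring_scope.

Definition vdot (R : realType) (d : nat) (u v : 'rV[R]_d) : R :=
  \sum_(j < d) u 0 j * v 0 j.
Definition vnorm (R : realType) (d : nat) (u : 'rV[R]_d) : R :=
  Num.sqrt (vdot u u).

Definition convex_fun (R : realType) (d : nat) (h : 'rV[R]_d -> R) : Prop :=
  forall (x y : 'rV[R]_d) (t : R), 0 <= t -> t <= 1 ->
    h (t *: x + (1 - t) *: y) <= t * h x + (1 - t) * h y.

Definition is_gradient (R : realType) (d : nat) (h : 'rV[R]_d -> R)
  (gh : 'rV[R]_d -> 'rV[R]_d) : Prop :=
  forall x, differentiable h x /\ forall v, 'd h x v = vdot (gh x) v.

Definition Lsmooth_grad (R : realType) (d : nat) (gh : 'rV[R]_d -> 'rV[R]_d)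
  (L : R) : Prop :=
  forall x y, vnorm (gh x - gh y) <= L * vnorm (x - y).

Definition favg (R : realType) (n d : nat) (f : 'I_n -> 'rV[R]_d -> R)
  (x : 'rV[R]_d) : R := n%:R^-1 * \sum_(i < n) f i x.
Definition fullgrad (R : realType) (n d : nat)
  (g : 'I_n -> 'rV[R]_d -> 'rV[R]_d) (x : 'rV[R]_d) : 'rV[R]_d :=
  n%:R^-1 *: \sum_(i < n) g i x.

Definition pk (R : realType) (n k : nat) : R :=
  Num.max (6 / (k%:R + 8)) (1 / n%:R).
Definition tauk (R : realType) (n k : nat) : R :=
  3 / (pk R n k * (k%:R + 8)).
Definition alphak (R : realType) (n : nat) (L : R) (k : nat) : R :=
  L * tauk R n k / (1 - tauk R n k).

(* One iteration k.  State = (z_k, xtilde_k); random outcome o = (i_k, b_k)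
   where i_k is the sampled component and b_k = true iff xtilde is updated
   (probability p_k).  z_{k+1} = argmin_x <G_k,x> + alpha_k/2 ||x - z_k||^2
   is written in its closed form z_k - G_k / alpha_k. *)
Definition acc_step (R : realType) (n d : nat) (L : R)
  (g : 'I_n -> 'rV[R]_d -> 'rV[R]_d) (k : nat)
  (st : 'rV[R]_d * 'rV[R]_d) (o : 'I_n * bool) : 'rV[R]_d * 'rV[R]_d :=
  let z := st.1 in let xt := st.2 in
  let tau := tauk R n k in
  let fg := fullgrad g xt in
  let y := tau *: z + (1 - tau) *: (xt - L^-1 *: fg) in
  let G := g o.1 y - g o.1 xt + fg in
  (z - (alphak n L k)^-1 *: G, if o.2 then y else xt).

Fixpoint acc_run (R : realType) (n d : nat) (L : R)
  (g : 'I_n -> 'rV[R]_d -> 'rV[R]_d) (k : nat)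
  (st : 'rV[R]_d * 'rV[R]_d) (s : seq ('I_n * bool)) : 'rV[R]_d * 'rV[R]_d :=
  match s with
  | [::] => st
  | o :: s' => acc_run L g k.+1 (acc_step L g k st o) s'
  end.

Definition xtilde (R : realType) (n d : nat) (L : R)
  (g : 'I_n -> 'rV[R]_d -> 'rV[R]_d) (x0 : 'rV[R]_d)
  (s : seq ('I_n * bool)) (k : nat) : 'rV[R]_d :=
  (acc_run L g 0 (x0, x0) (take k s)).2.

Fixpoint path_weight (R : realType) (n : nat) (k : nat)
  (s : seq ('I_n * bool)) : R :=
  match s with
  | [::] => 1
  | o :: s' => n%:R^-1 * (if o.2 then pk R n k else 1 - pk R n k)
               * path_weight R k.+1 s'
  end.

Definition Expect (R : realType) (n K : nat)
  (F : seq ('I_n * bool) -> R) : R :=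
  \sum_(t : K.-tuple ('I_n * bool)) path_weight R 0 t * F t.
Arguments Expect R n K F : clear implicits.

Definition out_prob (R : realType) (n K k : nat) : R :=
  (tauk R n k)^-2 / \sum_(j < K) (tauk R n j)^-2.

Definition E_grad_out (R : realType) (n d : nat) (L : R)
  (g : 'I_n -> 'rV[R]_d -> 'rV[R]_d) (x0 : 'rV[R]_d) (K : nat) : R :=
  Expect R n K (fun s =>
    \sum_(k < K) out_prob R n K k * vnorm (fullgrad g (xtilde L g x0 s k))).

Definition E_fgap (R : realType) (n d : nat) (L : R)
  (f : 'I_n -> 'rV[R]_d -> R) (g : 'I_n -> 'rV[R]_d -> 'rV[R]_d)
  (x0 xstar : 'rV[R]_d) (K : nat) : R :=
  Expect R n K (fun s => favg f (xtilde L g x0 s K)) - favg f xstar.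

(* Expected number of component-gradient evaluations in K iterations:
   n for grad f(xtilde_0), 2 per iteration for G_k, and n each time xtilde
   changes at an iteration k < K-1 (the new full gradient is then needed). *)
Definition E_cost (R : realType) (n K : nat) : R :=
  Expect R n K (fun s =>
    (n + 2 * K + n * count (fun o : 'I_n * bool => o.2) (take K.-1 s))%:R).

Definition bound_g (R : realType) (n : nat) (L R0 eps : R) : R :=
  n%:R * Num.max 1 (Num.min (ln (L * R0 / eps)) (ln n%:R))
  + (n%:R * L * R0) `^ (2 / 3) / eps `^ (2 / 3).
Definition bound_f (R : realType) (n : nat) (L R0 eps : R) : R :=
  n%:R * Num.max 1 (Num.min (ln (L * R0 ^+ 2 / eps)) (ln n%:R))
  + Num.sqrt (n%:R * L) * R0 / Num.sqrt eps.

(* Main.v *)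
Require Import Defs.
From HB Require Import structures.
From mathcomp Require Import all_boot all_order all_algebra.
From mathcomp Require Import all_classical all_reals all_analysis.
From mathcomp Require Import ring lra.
Import Order.TTheory GRing.Theory Num.Theory.
Import numFieldNormedType.Exports.
Local Open Scope ring_scope.

(* With A_k = (1 - tau_k) / (tau_k^2 p_k) and B_k = A_k (1 - tau_k p_k), the
   co-coercivity of the component gradients gives, in conditional expectation,
     A_k (f(xt_{k+1}) - f_min) + L/2 |z_{k+1} - x_min|^2
       + (1 - tau_k)^2 / (2 L tau_k^2) |grad f(xt_k)|^2
     <= B_k (f(xt_k) - f_min) + L/2 |z_k - x_min|^2,
   and B_{k+1} <= A_k because of the choice of p_k and tau_k.  Telescoping from
   z_0 = xt_0 = x_0 bounds both B_K (f(xt_K) - f_min) and the sum of the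
   tau_k^{-2} |grad f(xt_k)|^2 by a multiple of L R0^2, resp. L^2 R0^2.
   As B_K >= c max(K, K^2 / n) and tau_k^{-2} >= c max(1, k^2 / n^2), one takes K
   according to whichever regime reaches the accuracy first.  The expected cost
   is n + 2K + n (p_0 + ... + p_{K-2}) = O(K + n + n log(min(K, n))), since
   p_k = 6/(k+8) while k + 8 <= 6n, and p_k = 1/n afterwards. *)

(** * Averages over the components *)

Section Average.
Context {R : realType} (n : nat).
Implicit Types a b : 'I_n -> R.

Definition avg a : R := n%:R^-1 * \sum_i a i.

Lemma eq_avg a b : a =1 b -> avg a = avg b.
Proof. by move=> ab; congr (_ * _); apply: eq_bigr => i _. Qed.

Lemma avgD a b : avg (fun i => a i + b i) = avg a + avg b.
Proof. by rewrite /avg big_split mulrDr. Qed.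

Lemma avgZ c a : avg (fun i => c * a i) = c * avg a.
Proof. by rewrite /avg -mulr_sumr mulrCA. Qed.

Lemma ler_avg a b : (forall i, a i <= b i) -> avg a <= avg b.
Proof.
by move=> ab; apply: ler_wpM2l; [rewrite invr_ge0|apply: ler_sum => i _].
Qed.

Lemma avg_cst c : (0 < n)%N -> avg (fun=> c) = c.
Proof.
move=> n_gt0.
by rewrite /avg sumr_const card_ord -[c *+ n]mulr_natl mulKf// pnatr_eq0 -lt0n.
Qed.

End Average.

(** * Expectation over random runs, and the expected cost *)

Section Expectation.
Context {R : realType} (n : nat).
Implicit Types (k K m : nat) (s : seq ('I_n * bool)) (F G : seq ('I_n * bool) -> R).

Let weight k (o : 'I_n * bool) : R :=
  n%:R^-1 * (if o.2 then pk R n k else 1 - pk R n k).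

(** Conditioning on one outcome at a time turns the sum over tuples into a recursion; the starting
    iteration [k] is free so that inductions on [K] can shift it. *)
Fixpoint expect_from k K F : R :=
  if K is K'.+1 then
    \sum_(o : 'I_n * bool) weight k o * expect_from k.+1 K' (fun s => F (o :: s))
  else F [::].

Lemma sum_tuple_path_weight k K F :
  \sum_(t : K.-tuple ('I_n * bool)) path_weight R k t * F t = expect_from k K F.
Proof.
elim: K k F => [|K IHK] k F /=.
  rewrite (big_pred1 [tuple]) /= ?mul1r // => t.
  by rewrite [RHS]/= (tuple0 t) [RHS]eqxx.
pose h (p : ('I_n * bool) * K.-tuple ('I_n * bool)) := [tuple of p.1 :: p.2].
rewrite (reindex h) /=; last first.
  exists (fun t => (thead t, [tuple of behead t])); last first.
    by move=> t _; rewrite /h /= [RHS]tuple_eta.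
  by case=> o t _ /=; congr (_, _); apply: val_inj.
rewrite -(pair_bigA _ (fun o t => path_weight R k (o :: tval t) * F (o :: tval t))) /=.
apply: eq_bigr => o _; rewrite -IHK mulr_sumr; apply: eq_bigr => t _.
by rewrite mulrA.
Qed.

Lemma Expect_from K F : Expect R n K F = expect_from 0 K F.
Proof. exact: sum_tuple_path_weight. Qed.

Lemma expect_fromD k K F G :
  expect_from k K (fun s => F s + G s) = expect_from k K F + expect_from k K G.
Proof.
elim: K k F G => //= K IHK k F G; rewrite -big_split; apply: eq_bigr => o _.
by rewrite IHK mulrDr.
Qed.

Lemma expect_fromZ k K a F :
  expect_from k K (fun s => a * F s) = a * expect_from k K F.
Proof.
elim: K k F => //= K IHK k F; rewrite mulr_sumr; apply: eq_bigr => o _.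
by rewrite IHK mulrCA.
Qed.

Lemma eq_expect_from k K F G :
  (forall s, F s = G s) -> expect_from k K F = expect_from k K G.
Proof.
elim: K k F G => //= K IHK k F G FG; apply: eq_bigr => o _.
by congr (_ * _); apply: IHK => s.
Qed.

Lemma pk_ge0 k : 0 <= pk R n k.
Proof. by rewrite /pk le_max; apply/orP; right; rewrite divr_ge0 ?ler0n. Qed.

Lemma pk_le1 k : pk R n k <= 1.
Proof.
rewrite /pk ge_max; apply/andP; split.
  rewrite ler_pdivrMr ?mul1r -?natrD ?ltr0n ?addn_gt0 ?orbT// ler_nat.
  exact: leq_trans (leq_addl _ _).
by case: (n) => [|m]; rewrite ?invr0 ?mulr0// ler_pdivrMr ?ltr0n// mul1r ler1n.
Qed.

Lemma weight_ge0 k o : 0 <= weight k o.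
Proof.
rewrite /weight mulr_ge0 ?invr_ge0 ?ler0n//.
by case: ifP => _; rewrite ?pk_ge0// subr_ge0 pk_le1.
Qed.

Lemma ler_expect_from k K F G :
  (forall s, F s <= G s) -> expect_from k K F <= expect_from k K G.
Proof.
elim: K k F G => //= K IHK k F G FG; apply: ler_sum => o _.
by rewrite ler_wpM2l ?weight_ge0//; apply: IHK => s.
Qed.

Lemma sum_weight k (F : 'I_n -> bool -> R) :
  \sum_o weight k o * F o.1 o.2 =
  pk R n k * avg n (F^~ true) + (1 - pk R n k) * avg n (F^~ false).
Proof.
rewrite -(pair_bigA _ (fun i b => weight k (i, b) * F i b)) /=.
rewrite /avg !mulr_sumr -big_split; apply: eq_bigr => i _.
by rewrite big_bool /weight /=; ring.
Qed.

Hypothesis n_gt0 : (0 < n)%N.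

Lemma expect_from_cst k K a : expect_from k K (fun=> a) = a.
Proof.
elim: K k => //= K IHK k; under eq_bigr do rewrite IHK.
by rewrite (sum_weight k (fun _ _ => a)) !avg_cst//; ring.
Qed.

(** Linearity of expectation: the update at iteration [k + j] occurs with probability
    [pk R n (k + j)], whatever happened before. *)
Lemma expect_from_count k K m : (m <= K)%N ->
  expect_from k K (fun s => (count (fun o : 'I_n * bool => o.2) (take m s))%:R) =
  \sum_(j < m) pk R n (k + j).
Proof.
elim: m k K => [|m IHm] k K mK.
  rewrite big_ord0; apply: etrans (expect_from_cst k K 0).
  by apply: eq_expect_from => s; rewrite take0.
case: K mK => // K mK.
have step o : expect_from k.+1 K
    (fun s => (count (fun o : 'I_n * bool => o.2) (take m.+1 (o :: s)))%:R) =
    (o.2 : nat)%:R + \sum_(j < m) pk R n (k.+1 + j).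
  rewrite -(IHm k.+1 K mK) -(expect_from_cst k.+1 K (o.2 : nat)%:R) -expect_fromD.
  by apply: eq_expect_from => s; rewrite /= natrD.
rewrite [LHS]/=; under eq_bigr => o _ do rewrite step.
rewrite (sum_weight k (fun _ b => (b : nat)%:R + _)) !avg_cst//.
rewrite big_ord_recl addn0 /=.
under [in RHS]eq_bigr do rewrite /bump /= addnCA addnA add1n.
by ring.
Qed.

Lemma E_cost_eq K :
  E_cost R n K = n%:R + 2 * K%:R + n%:R * \sum_(j < K.-1) pk R n j.
Proof.
rewrite /E_cost Expect_from.
rewrite (eq_expect_from _ _ _ (fun s => (n + 2 * K)%:R + n%:R *
  (count (fun o : 'I_n * bool => o.2) (take K.-1 s))%:R)); last first.
  by move=> s; rewrite natrD natrM.
rewrite expect_fromD expect_from_cst expect_fromZ expect_from_count ?leq_pred//.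
by rewrite natrD natrM.
Qed.

End Expectation.

(** * The Euclidean inner product *)

Section InnerProduct.
Context {R : realType} {d : nat}.
Implicit Types (u v w : 'rV[R]_d) (a : R).

Lemma vdotC u v : vdot u v = vdot v u.
Proof. by apply: eq_bigr => j _; rewrite mulrC. Qed.

Lemma vdotDl u v w : vdot (u + v) w = vdot u w + vdot v w.
Proof. by rewrite -big_split; apply: eq_bigr => j _; rewrite mxE mulrDl. Qed.

Lemma vdotZl a u v : vdot (a *: u) v = a * vdot u v.
Proof. by rewrite mulr_sumr; apply: eq_bigr => j _; rewrite mxE mulrA. Qed.

Lemma vdotDr u v w : vdot w (u + v) = vdot w u + vdot w v.
Proof. by rewrite !(vdotC w) vdotDl. Qed.

Lemma vdotZr a u v : vdot v (a *: u) = a * vdot v u.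
Proof. by rewrite !(vdotC v) vdotZl. Qed.

Lemma vdotNl u v : vdot (- u) v = - vdot u v.
Proof. by rewrite -scaleN1r vdotZl mulN1r. Qed.

Lemma vdotNr u v : vdot v (- u) = - vdot v u.
Proof. by rewrite !(vdotC v) vdotNl. Qed.

Definition vdotE := (vdotDl, vdotDr, vdotZl, vdotZr, vdotNl, vdotNr).

Lemma vdot_suml (I : finType) (F : I -> 'rV[R]_d) v :
  vdot (\sum_i F i) v = \sum_i vdot (F i) v.
Proof.
apply: (big_ind2 (fun u a => vdot u v = a)) => //.
- by rewrite /vdot big1// => j _; rewrite mxE mul0r.
- by move=> ? ? ? ? <- <-; rewrite vdotDl.
Qed.

Lemma vdot_ge0 u : 0 <= vdot u u.
Proof. by apply: sumr_ge0 => j _; rewrite -expr2 sqr_ge0. Qed.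

Lemma vdot_eq0 u : vdot u u <= 0 -> u = 0.
Proof.
move=> u0; apply/rowP => j; rewrite mxE; apply/eqP.
rewrite -sqrf_eq0 expr2; apply/eqP.
apply: (psumr_eq0P (P := predT) (F := fun j => u 0 j * u 0 j)) => //.
- by move=> i _; rewrite -expr2 sqr_ge0.
- by apply/eqP; rewrite eq_le u0 vdot_ge0.
Qed.

Lemma vnorm_ge0 u : 0 <= vnorm u.
Proof. exact: sqrtr_ge0. Qed.

Lemma sqr_vnorm u : vnorm u ^+ 2 = vdot u u.
Proof. by rewrite sqr_sqrtr ?vdot_ge0. Qed.

End InnerProduct.

(** * Inequalities for a convex function with Lipschitz gradient *)

Section Smoothness.
Local Open Scope classical_set_scope.
Context {R : realType} {d : nat}.
Variables (h : 'rV[R]_d -> R) (gh : 'rV[R]_d -> 'rV[R]_d) (L : R).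
Hypotheses (h_convex : convex_fun h) (h_grad : is_gradient h gh).
Hypotheses (L_gt0 : 0 < L) (h_smooth : Lsmooth_grad gh L).
Implicit Types x y v : 'rV[R]_d.

(** Convexity bounds each difference quotient along [y - x] by [h y - h x] for [0 < t < 1], hence
    the passage to the one-sided limit. *)
Lemma convex_subgradient x y : h x + vdot (gh x) (y - x) <= h y.
Proof.
have [dhx dhxE] := h_grad x.
rewrite -lerBrDl -dhxE -deriveE//.
have /cvg_ex[l hl] : derivable h x (y - x) by exact: diff_derivable.
rewrite /derive (cvg_lim _ hl)//.
have hl' : (fun t : R => t^-1 *: (h (t *: (y - x) + x) - h x)) @ 0^'+ --> l.
  exact: cvg_dnbhs_at_right.
apply: (cvgr_to_le hl').
near=> t.
have t0 : 0 < t by near: t; exact: nbhs_right_gt.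
have t1 : t < 1 by near: t; exact: nbhs_right_lt.
rewrite /GRing.scale/= ler_pdivrMl// lerBlDr.
have := h_convex y x t (ltW t0) (ltW t1).
have -> : t *: y + (1 - t) *: x = t *: (y - x) + x.
  by rewrite scalerBl scale1r scalerBr addrAC addrA.
by move=> /le_trans; apply; lra.
Unshelve. all: by end_near. Qed.

Lemma Lsmooth_vdot x y :
  vdot (gh x - gh y) (gh x - gh y) <= L ^+ 2 * vdot (x - y) (x - y).
Proof.
rewrite -!sqr_vnorm -exprMn lerXn2r ?nnegrE ?mulr_ge0 ?vnorm_ge0 ?(ltW L_gt0)//.
Qed.

(** With [u] the gradient difference, [|u - L v|^2 >= 0] and [|u| <= L |v|] give the bound without
    Cauchy-Schwarz. *)
Lemma Lsmooth_monotone x v : vdot (gh (x + v) - gh x) v <= L * vdot v v.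
Proof.
have := Lsmooth_vdot (x + v) x; rewrite addrAC subrr add0r.
move: (gh (x + v) - gh x) => u uv; rewrite -(ler_pM2l L_gt0).
have := vdot_ge0 (u - L *: v).
by rewrite !vdotE (vdotC v u); nra.
Qed.

(* Each halving of the step moves the constant [L / 2 + e] to [L / 2 + e / 2]. *)
Lemma descent_halving k x v :
  h (x + v) <= h x + vdot (gh x) v + (L / 2 + L / 2 / 2 ^+ k) * vdot v v.
Proof.
elim: k x v => [|k IHk] x v.
  (* Convexity at [x + v] alone yields the constant [L], that is [L / 2 + L / 2]. *)
  have := convex_subgradient (x + v) x; have := Lsmooth_monotone x v.
  by rewrite opprD addrA subrr add0r !vdotE expr0; lra.
have -> : x + v = (x + 2^-1 *: v) + 2^-1 *: v.
  by rewrite -addrA -scalerDl (_ : 2^-1 + 2^-1 = 1) ?scale1r//; lra.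
have := IHk (x + 2^-1 *: v) (2^-1 *: v); have := IHk x (2^-1 *: v).
(* Two half-steps with constant [c] contribute [c / 2]; replacing the midpoint gradient by [gh x]
   adds [L / 4]. *)
have := Lsmooth_monotone x (2^-1 *: v).
rewrite !vdotE exprS invfM; set c := (2 ^+ k)^-1; lra.
Qed.

(** The limit of [descent_halving] as [k] grows, in place of integrating the gradient along a
    segment. *)
Lemma descent x v : h (x + v) <= h x + vdot (gh x) v + L / 2 * vdot v v.
Proof.
have cvg2 : (fun k => h x + vdot (gh x) v + (L / 2 + L / 2 * (2^-1) ^+ k) * vdot v v)
    @ \oo --> h x + vdot (gh x) v + (L / 2 + L / 2 * 0) * vdot v v.
  apply: cvgD; first exact: cvg_cst.
  apply: cvgM; last exact: cvg_cst.
  apply: cvgD; first exact: cvg_cst.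
  apply: cvgM; first exact: cvg_cst.
  apply: cvg_expr.
  by rewrite ger0_norm// invf_lt1// ltr1n.
rewrite mulr0 addr0 in cvg2; apply: (cvgr_to_ge cvg2).
by near=> k; rewrite exprVn; exact: descent_halving.
Unshelve. all: by end_near. Qed.

(* [u |-> h u - <gh y, u>] is minimal at [y] and decreases by
   [|gh x - gh y|^2 / (2 L)] along a gradient step from [x]. *)
Lemma convex_cocoercive x y :
  h y + vdot (gh y) (x - y) + (2 * L)^-1 * vdot (gh x - gh y) (gh x - gh y) <= h x.
Proof.
have := descent x (- L^-1 *: (gh x - gh y)).
have := convex_subgradient y (x + - L^-1 *: (gh x - gh y)).
have -> w : vdot (gh x) w = vdot (gh x - gh y) w + vdot (gh y) w.
  by rewrite -vdotDl subrK.
move: (gh x - gh y) => u.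
rewrite !vdotE invfM.
have := mulVf (lt0r_neq0 L_gt0); set c := L^-1 => cL.
have -> : L / 2 * (- c * (- c * vdot u u)) = c * L * c / 2 * vdot u u by ring.
by rewrite cL; lra.
Qed.

End Smoothness.

(** * Step sizes and the growth of the coefficients *)

Section StepSizes.
Context {R : realType} (n : nat).
Hypothesis n_gt0 : (0 < n)%N.
Implicit Type k : nat.

Let n0 : 0 < n%:R :> R. Proof. by rewrite ltr0n. Qed.
Let k8 k : 0 < k%:R + 8 :> R. Proof. by rewrite ltr_wpDl ?ler0n. Qed.

Lemma pk_early k : (k + 8 <= 6 * n)%N -> pk R n k = 6 / (k%:R + 8).
Proof.
move=> kn; apply/max_idPl.
rewrite ler_pdivrMr// mulrAC ler_pdivlMr// mul1r.
by rewrite -natrD -natrM ler_nat.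
Qed.

Lemma pk_late k : (6 * n <= k + 8)%N -> pk R n k = 1 / n%:R.
Proof.
move=> kn; apply/max_idPr.
rewrite ler_pdivrMr// mulrAC ler_pdivlMr// mul1r.
by rewrite -natrD -natrM ler_nat.
Qed.

Lemma pk_ge_early k : 6 / (k%:R + 8) <= pk R n k.
Proof. by rewrite /pk le_max lexx. Qed.

Lemma pk_ge_late k : 1 / n%:R <= pk R n k.
Proof. by rewrite /pk le_max lexx orbT. Qed.

Lemma pk_gt0 k : 0 < pk R n k.
Proof. by apply: lt_le_trans (pk_ge_late k); rewrite divr_gt0. Qed.

Lemma tauk_gt0 k : 0 < tauk R n k.
Proof. by rewrite /tauk divr_gt0// mulr_gt0// pk_gt0. Qed.

Lemma tauk_le k : tauk R n k <= 1 / 2.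
Proof.
have := pk_ge_early k; rewrite ler_pdivrMr// => pk6.
rewrite /tauk ler_pdivrMr ?mulr_gt0 ?pk_gt0//; lra.
Qed.

Lemma tauk_pk k : tauk R n k * pk R n k = 3 / (k%:R + 8).
Proof. by rewrite /tauk; field; rewrite !lt0r_neq0// pk_gt0. Qed.

(* In the bound for step [k], [coefA k] weighs [E f(xtilde_(k+1)) - f(xstar)] and
   [coefB k] weighs [f(xtilde_k) - f(xstar)]. *)
Definition coefA k : R := (1 - tauk R n k) / (tauk R n k ^+ 2 * pk R n k).
Definition coefB k : R := coefA k * (1 - tauk R n k * pk R n k).

(** In this regime [tauk] is constantly 1/2; in the late one it is [3 n / (k + 8)]. *)
Lemma coefA_early k : (k + 8 <= 6 * n)%N -> coefA k = (k%:R + 8) / 3.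
Proof.
move=> kn; rewrite /coefA /tauk pk_early//.
by field; rewrite !lt0r_neq0.
Qed.

Lemma coefA_late k : (6 * n <= k + 8)%N ->
  coefA k = (k%:R + 8) * (k%:R + 8 - 3 * n%:R) / (9 * n%:R).
Proof.
move=> kn; rewrite /coefA /tauk pk_late//.
by field; rewrite !lt0r_neq0.
Qed.

Lemma coefB_le_coefA k : coefB k.+1 <= coefA k.
Proof.
have k9 : 0 < k%:R + 1 + 8 :> R by rewrite natr1.
rewrite /coefB tauk_pk -[k.+1%:R]natr1.
(* The regimes overlap when [k + 8 = 6 n], so [k] and [k.+1] can always be put in the same one. The
   late case reduces to [6 n <= k + 10]. *)
have [kn|kn] := leqP (k.+1 + 8) (6 * n).
  rewrite !coefA_early ?(leq_trans _ kn) ?addSn// -[k.+1%:R]natr1.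
  have -> : (k%:R + 1 + 8) / 3 * (1 - 3 / (k%:R + 1 + 8)) = (k%:R + 6) / 3 :> R.
    by field; rewrite !lt0r_neq0.
  lra.
have kn' : (6 * n <= k + 8)%N by rewrite -ltnS -addSn.
rewrite !coefA_late ?(ltnW kn)// -[k.+1%:R]natr1.
have -> : (k%:R + 1 + 8) * (k%:R + 1 + 8 - 3 * n%:R) / (9 * n%:R) *
    (1 - 3 / (k%:R + 1 + 8)) =
    (k%:R + 6) * (k%:R + 9 - 3 * n%:R) / (9 * n%:R) :> R.
  by field; rewrite !lt0r_neq0.
rewrite ler_wpM2r ?invr_ge0 ?mulr_ge0 ?ler0n//.
have : 6 * n%:R <= k%:R + 8 :> R by rewrite -natrD -natrM ler_nat.
by nra.
Qed.

Lemma coefB0_le3 : coefB 0 <= 3.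
Proof.
rewrite /coefB tauk_pk.
(* Iteration 0 is late only for [n = 1]; the values are 5/3 and 25/9. *)
have [n2|n1] := leqP 2 n.
  by rewrite coefA_early ?(leq_trans _ (leq_mul (leqnn 6) n2))// add0r; lra.
have nE : n = 1%N by apply/eqP; rewrite eqn_leq n_gt0 -ltnS n1.
by rewrite coefA_late nE// add0r; lra.
Qed.

(** Here [1 - tau >= 1/2] and [1 - tau p >= 5/8], while [p (k + 8)^2] is [9 / (tau^2 p)]; this gives
    [5/16 / 9 = 5/144]. *)
Lemma coefB_ge k : 5 / 144 * (pk R n k * (k%:R + 8) ^+ 2) <= coefB k.
Proof.
have p0 := pk_gt0 k; have := k8 k; have := tauk_le k.
have t0 := tauk_gt0 k; have := tauk_pk k.
rewrite /coefB /coefA => tp tau K8.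
have -> : pk R n k * (k%:R + 8) ^+ 2 =
    9 / (tauk R n k ^+ 2 * pk R n k).
  rewrite (_ : 9 = (3 / (k%:R + 8) * (k%:R + 8)) ^+ 2); last first.
    by rewrite divfK ?lt0r_neq0//; ring.
  by rewrite -tp; field; rewrite !lt0r_neq0.
have D0 : 0 < (tauk R n k ^+ 2 * pk R n k)^-1 by rewrite invr_gt0 mulr_gt0// exprn_gt0.
have : 3 / (k%:R + 8) <= 3 / 8 :> R.
  by rewrite ler_pM2l// lef_pV2 ?posrE// lerDr.
rewrite tp; set r := 3 / _; set D := (_ * _)^-1 in D0 *.
set t := tauk _ _ _ in tau * => r3.
have : 5 / 16 <= (1 - t) * (1 - r) by nra.
by move=> /(ler_wpM2l (ltW D0)); lra.
Qed.

Lemma coefB_ge0 k : 0 <= coefB k.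
Proof.
apply: le_trans (coefB_ge k).
by rewrite !mulr_ge0 ?sqr_ge0 ?(ltW (pk_gt0 k)).
Qed.

(** This bound and the next use one argument of the maximum in [pk] each, so both hold for every
    [k]. *)
Lemma coefB_ge_early k : 5 / 24 * k%:R <= coefB k.
Proof.
have := pk_ge_early k; rewrite ler_pdivrMr// => pk6.
by apply: le_trans (coefB_ge k); have := k8 k; nra.
Qed.

Lemma coefB_ge_late k : 5 / 144 * (k%:R ^+ 2 / n%:R) <= coefB k.
Proof.
apply: le_trans (coefB_ge k); rewrite ler_wpM2l// mulrC -[_^-1]mul1r.
apply: ler_pM; rewrite ?pk_ge_late ?sqr_ge0 ?divr_ge0 ?ler0n//.
by rewrite lerXn2r ?nnegrE ?ler0n ?(ltW (k8 k))// lerDl.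
Qed.

Lemma tauk_invsq_ge k : (k%:R + 8) ^+ 2 / (9 * n%:R ^+ 2) <= (tauk R n k)^-2.
Proof.
have -> : (tauk R n k)^-2 = (pk R n k * (k%:R + 8)) ^+ 2 / 9.
  by rewrite /tauk; field; rewrite !lt0r_neq0// pk_gt0.
have -> : (k%:R + 8) ^+ 2 / (9 * n%:R ^+ 2) = (1 / n%:R * (k%:R + 8)) ^+ 2 / 9 :> R.
  by field; rewrite lt0r_neq0.
rewrite ler_pM2r// lerXn2r ?nnegrE ?mulr_ge0 ?(ltW (k8 k)) ?(ltW (pk_gt0 k))
  ?divr_ge0 ?ler0n//.
by rewrite ler_pM2r ?pk_ge_late.
Qed.

Lemma tauk_invsq_ge4 k : 4 <= (tauk R n k)^-2.
Proof.
have t0 := tauk_gt0 k; have := tauk_le k => t2.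
rewrite -[4]invrK lef_pV2 ?posrE ?exprn_gt0//.
by nra.
Qed.

Lemma sum_tauk_invsq_ge4 K : 4 * K%:R <= \sum_(k < K) (tauk R n k)^-2.
Proof.
have -> : 4 * K%:R = \sum_(k < K) 4 :> R by rewrite sumr_const card_ord mulr_natr.
by apply: ler_sum => k _; exact: tauk_invsq_ge4.
Qed.

Lemma sum_tauk_invsq_ge K :
  K%:R ^+ 3 / (27 * n%:R ^+ 2) <= \sum_(k < K) (tauk R n k)^-2.
Proof.
elim: K => [|K IHK]; first by rewrite big_ord0 expr0n mul0r.
(* What remains is [(K + 1)^3 - K^3 <= 3 (K + 8)^2]. *)
rewrite big_ord_recr /=; apply: le_trans (lerD IHK (tauk_invsq_ge K)).
rewrite -[K.+1%:R]natr1.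
have -> : (K%:R + 8) ^+ 2 / (9 * n%:R ^+ 2) =
    3 * (K%:R + 8) ^+ 2 / (27 * n%:R ^+ 2) :> R by field; rewrite lt0r_neq0.
rewrite -mulrDl ler_wpM2r ?invr_ge0 ?mulr_ge0 ?sqr_ge0//.
by have : 0 <= K%:R :> R by []; nra.
Qed.

(** Early terms [6 / (k + 8)] are dominated by increments of [6 ln]; once [m + 7] exceeds [6 n] the
    logarithm is frozen and each term is [1 / n]. *)
Lemma sum_pk_le m :
  \sum_(k < m) pk R n k <= m%:R / n%:R + 6 * ln (minn (m + 7) (6 * n))%:R.
Proof.
elim: m => [|m IHm].
  rewrite big_ord0 mul0r add0r mulr_ge0// ln_ge0// ler1n leq_min.
  by rewrite add0n/= muln_gt0.
have n1 : (0 < minn (m + 7) (6 * n))%N by rewrite leq_min muln_gt0 n_gt0 addnS.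
rewrite big_ord_recr [leLHS]/= -[m.+1%:R]natr1 mulrDl.
have [mn|mn] := leqP (m.+1 + 7) (6 * n); last first.
  rewrite pk_late 1?(leq_trans (ltnW mn)) ?addSnnS//.
  rewrite (minn_idPr _) in IHm; last by rewrite -ltnS.
  lra.
have m7 : 0 < m%:R + 7 :> R by rewrite ltr_wpDl.
rewrite pk_early; last by rewrite -addSnnS.
rewrite (minn_idPl _) in IHm; last by rewrite ltnW.
have : ln (m + 7)%:R - ln (m.+1 + 7)%:R <= - (m%:R + 8)^-1 :> R.
  rewrite -ln_div ?posrE ?ltr0n ?addn_gt0 ?orbT// !natrD -[m.+1%:R]natr1.
  have -> : (m%:R + 7) / (m%:R + 1 + 7) = 1 + - (m%:R + 8)^-1 :> R.
    by field; rewrite !lt0r_neq0//; lra.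
  by apply: le_ln1Dx; rewrite ltrN2 invf_lt1//; lra.
have : 0 <= 1 / n%:R :> R by rewrite divr_ge0.
by lra.
Qed.

End StepSizes.

(** * One-step decrease of the potential, and telescoping *)

Section Potential.
Context {R : realType} {n d : nat}.
Variables (f : 'I_n -> 'rV[R]_d -> R) (g : 'I_n -> 'rV[R]_d -> 'rV[R]_d).
Variables (L : R) (xstar : 'rV[R]_d).
Hypotheses (n_gt0 : (0 < n)%N) (L_gt0 : 0 < L).
Hypotheses (f_convex : forall i, convex_fun (f i))
  (f_grad : forall i, is_gradient (f i) (g i))
  (f_smooth : forall i, Lsmooth_grad (g i) L)
  (f_min : forall x, favg f xstar <= favg f x).
Implicit Types x y z v : 'rV[R]_d.

Let favgE x : favg f x = avg n (fun i => f i x). Proof. by []. Qed.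

Lemma vdot_fullgrad x v : vdot (fullgrad g x) v = avg n (fun i => vdot (g i x) v).
Proof. by rewrite /fullgrad vdotZl vdot_suml. Qed.

Lemma favg_subgradient x y : favg f x + vdot (fullgrad g x) (y - x) <= favg f y.
Proof.
rewrite !favgE vdot_fullgrad -avgD; apply: ler_avg => i.
exact: convex_subgradient.
Qed.

Lemma favg_descent x v :
  favg f (x + v) <= favg f x + vdot (fullgrad g x) v + L / 2 * vdot v v.
Proof.
rewrite !favgE vdot_fullgrad -[L / 2 * _](avg_cst n)// -!avgD; apply: ler_avg => i.
exact: descent.
Qed.

Lemma favg_cocoercive x y :
  favg f y + vdot (fullgrad g y) (x - y) +
    (2 * L)^-1 * avg n (fun i => vdot (g i x - g i y) (g i x - g i y)) <= favg f x.
Proof.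
rewrite !favgE vdot_fullgrad -avgZ -!avgD; apply: ler_avg => i.
exact: convex_cocoercive.
Qed.

(** Otherwise a gradient step of length [1 / L] would go below the minimum. *)
Lemma fullgrad_minimizer : fullgrad g xstar = 0.
Proof.
apply: vdot_eq0; set F := fullgrad g xstar.
have := le_trans (f_min _) (favg_descent xstar (- L^-1 *: F)).
rewrite -/F; clearbody F; rewrite !vdotE.
have -> : L / 2 * (- L^-1 * (- L^-1 * vdot F F)) = L^-1 / 2 * vdot F F.
  by field; rewrite lt0r_neq0.
have Li : 0 < L^-1 by rewrite invr_gt0.
by rewrite -(pmulr_rle0 _ Li); lra.
Qed.

Lemma favg_gap x :
  favg f x - favg f xstar <= L / 2 * vdot (x - xstar) (x - xstar).
Proof.
have := favg_descent xstar (x - xstar).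
rewrite fullgrad_minimizer (addrC xstar) subrK -[0](scale0r 0) vdotZl mul0r.
by lra.
Qed.

Lemma avg_sqr_dist z y x c :
  avg n (fun i => let z' := z - c *: (g i y - g i x + fullgrad g x) in
                vdot (z' - xstar) (z' - xstar)) =
  vdot (z - xstar) (z - xstar) - 2 * c * vdot (fullgrad g y) (z - xstar) +
  c ^+ 2 * (avg n (fun i => vdot (g i x - g i y) (g i x - g i y)) +
    2 * vdot (fullgrad g y) (fullgrad g x) -
    vdot (fullgrad g x) (fullgrad g x)).
Proof.
set F := fullgrad g x; set w := z - xstar.
(* [N] is [|w - c F|^2], the part free of [i]; with everything under one average, the identity holds
   for each [i] separately. *)
pose N := vdot w w - 2 * c * vdot F w + c ^+ 2 * vdot F F.
have -> : vdot w w - 2 * c * vdot (fullgrad g y) w +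
  c ^+ 2 * (avg n (fun i => vdot (g i x - g i y) (g i x - g i y)) +
    2 * vdot (fullgrad g y) F - vdot F F) =
  N + (- (2 * c)) * (vdot (fullgrad g y) w + (-1) * vdot (fullgrad g x) w) +
  c ^+ 2 * (avg n (fun i => vdot (g i x - g i y) (g i x - g i y))) +
  (2 * c ^+ 2) * (vdot (fullgrad g y) F + (-1) * vdot (fullgrad g x) F).
  by rewrite /N -/F; ring.
rewrite -[N](avg_cst n)// !vdot_fullgrad -!avgZ -!avgD -!avgZ -!avgD.
apply: eq_avg => i /=.
rewrite (_ : _ - xstar = w - c *: (g i y - g i x + F)); last by rewrite addrAC.
rewrite -[g i x - g i y]opprB vdotNl vdotNr opprK.
have E v : vdot (g i y) v + (-1) * vdot (g i x) v = vdot (g i y - g i x) v.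
  by rewrite vdotDl vdotNl mulN1r.
rewrite !E /N; move: (g i y - g i x) => D; clearbody F w.
by rewrite !vdotE (vdotC w F) (vdotC w D) (vdotC F D); ring.
Qed.

(* With this [alphak], the cross terms [<grad f y, grad f x>] and the variances
   of the two gradient estimates cancel exactly. *)
Lemma mean_step_bound tau alpha z x y : 0 < tau -> tau < 1 ->
  alpha = L * tau / (1 - tau) ->
  y = tau *: z + (1 - tau) *: (x - L^-1 *: fullgrad g x) ->
  (1 - tau) / tau ^+ 2 * (favg f y - favg f xstar) +
  (1 - tau) ^+ 2 / (2 * L * tau ^+ 2) * vdot (fullgrad g x) (fullgrad g x) +
  L / 2 * avg n (fun i =>
    let z' := z - alpha^-1 *: (g i y - g i x + fullgrad g x) in
    vdot (z' - xstar) (z' - xstar)) <=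
  (1 - tau) ^+ 2 / tau ^+ 2 * (favg f x - favg f xstar) +
  L / 2 * vdot (z - xstar) (z - xstar).
Proof.
move=> t0 t1 alphaE yE; have s0 : 0 < 1 - tau by rewrite subr_gt0.
rewrite avg_sqr_dist; set F := fullgrad g x.
have ybar : tau *: (y - xstar) =
    tau *: (z - xstar) + (1 - tau) *: (x - y - L^-1 *: F).
  apply/rowP => j; rewrite yE -/F !mxE; ring.
have := congr1 (vdot (fullgrad g y)) ybar.
have := favg_cocoercive x y; have := favg_subgradient y xstar.
clearbody F; move: (fullgrad g y) => Fy.
rewrite -[xstar - y]opprB !(vdotDr, vdotNr, vdotZr).
set S := avg _ _; set W := vdot Fy F.
set N := vdot F F; set Z := vdot (z - xstar) _.
set gz := vdot _ z; set gx := vdot _ x; set gy := vdot _ y; set gs := vdot _ xstar.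
set fy := favg f y; set fx := favg f x; set fs := favg f xstar.
rewrite invfM => sub coc ybarE.
(* [tau] times convexity between [y] and [xstar], plus [1 - tau] times co-coercivity between [x] and
   [y]; [ybarE] trades [y] for [z]. *)
have key : fy - fs + (1 - tau) * (L^-1 / 2) * (S + 2 * W) - tau * (gz - gs)
    <= (1 - tau) * (fx - fs).
  have := ler_wpM2l (ltW t0) sub; have := ler_wpM2l (ltW s0) coc; lra.
have c0 : 0 <= (1 - tau) / tau ^+ 2 by rewrite divr_ge0 ?sqr_ge0 ?ltW.
have := ler_wpM2l c0 key; rewrite -subr_ge0 => H.
(* After scaling by [(1 - tau) / tau^2], [key] and the goal have equal gaps. *)
rewrite -subr_ge0; apply: le_trans H _; rewrite le_eqVlt; apply/orP; left; apply/eqP.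
rewrite alphaE; field; rewrite !lt0r_neq0//.
Qed.

Definition potential k (st : 'rV[R]_d * 'rV[R]_d) : R :=
  coefB n k * (favg f st.2 - favg f xstar) +
  L / 2 * vdot (st.1 - xstar) (st.1 - xstar).

Definition coefG k : R := (1 - tauk R n k) ^+ 2 / (2 * L * tauk R n k ^+ 2).

Lemma potential_step k st :
  coefG k * vdot (fullgrad g st.2) (fullgrad g st.2) +
  \sum_o n%:R^-1 * (if o.2 then pk R n k else 1 - pk R n k) *
    potential k.+1 (acc_step L g k st o) <= potential k st.
Proof.
case: st => z x /=.
have p0 := @pk_gt0 R n n_gt0 k; have p1 := @pk_le1 R n k.
have t0 := @tauk_gt0 R n n_gt0 k; have t2 := @tauk_le R n n_gt0 k.
have t1 : tauk R n k < 1 by lra.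
rewrite (sum_weight n k (fun i b => potential k.+1 (acc_step L g k (z, x) (i, b)))).
rewrite /potential /acc_step /=.
set y := tauk _ _ _ *: z + _.
have := mean_step_bound _ _ z x y t0 t1 erefl erefl; rewrite /= -/(alphak n L k).
rewrite !avgD !avgZ !avg_cst//.
set V := avg _ _; set N := vdot (fullgrad g x) _; set Z := vdot _ _.
have X0 : 0 <= favg f x - favg f xstar by rewrite subr_ge0.
have Y0 : 0 <= favg f y - favg f xstar by rewrite subr_ge0.
move: X0 Y0; set X := favg f x - _; set Y := favg f y - _ => X0 Y0 step.
have pXY0 : 0 <= pk R n k * Y + (1 - pk R n k) * X.
  by rewrite addr_ge0// mulr_ge0// ?subr_ge0// ltW.
(* Passing from [coefB n k.+1] to [coefA n k] makes the [Y] coefficient that of [mean_step_bound],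
   since [coefA * p = (1 - tau) / tau^2]. *)
have := ler_wpM2r pXY0 (coefB_le_coefA n n_gt0 k).
rewrite [coefB n k]/coefB.
have -> : coefA n k * (pk R n k * Y + (1 - pk R n k) * X) =
    (1 - tauk R n k) / tauk R n k ^+ 2 * Y +
    coefA n k * (1 - tauk R n k * pk R n k) * X -
    (1 - tauk R n k) ^+ 2 / tauk R n k ^+ 2 * X.
  by rewrite /coefA; field; rewrite !lt0r_neq0.
by move: step; rewrite -/(coefG k); lra.
Qed.

(** Telescopes [potential_step] by conditioning on the first outcome, from any iteration and
    state. *)
Lemma potential_run K k st :
  expect_from n k K (fun s =>
    \sum_(j < K) coefG (k + j) *
      vdot (fullgrad g (acc_run L g k st (take j s)).2)
           (fullgrad g (acc_run L g k st (take j s)).2)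
    + potential (k + K) (acc_run L g k st (take K s))) <= potential k st.
Proof.
elim: K k st => [|K IHK] k st.
  by rewrite /= big_ord0 add0r addn0.
apply: le_trans (potential_step k st).
rewrite (eq_expect_from _ _ _ _ (fun s =>
  coefG k * vdot (fullgrad g st.2) (fullgrad g st.2) +
  (\sum_(j < K) coefG (k + j.+1) *
      vdot (fullgrad g (acc_run L g k st (take j.+1 s)).2)
           (fullgrad g (acc_run L g k st (take j.+1 s)).2)
    + potential (k + K.+1) (acc_run L g k st (take K.+1 s))))); last first.
  by move=> s; rewrite big_ord_recl take0 addn0 -addrA.
rewrite expect_fromD (expect_from_cst n n_gt0) lerD2l /=.
apply: ler_sum => o _; rewrite ler_wpM2l ?weight_ge0//.
apply: le_trans (IHK k.+1 (acc_step L g k st o)).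
apply: ler_expect_from => s; rewrite -addSnnS lerD2r.
by under eq_bigr do rewrite -addSnnS.
Qed.

(** The initial gap is at most [L R0^2 / 2], so the two terms give [3/2 + 1/2]. *)
Lemma potential0 R0 x0 : vnorm (x0 - xstar) <= R0 ->
  potential 0 (x0, x0) <= 2 * (L * R0 ^+ 2).
Proof.
move=> x0R0; have R00 := le_trans (vnorm_ge0 _) x0R0.
have : vdot (x0 - xstar) (x0 - xstar) <= R0 ^+ 2.
  by rewrite -sqr_vnorm lerXn2r ?nnegrE ?vnorm_ge0.
have := favg_gap x0; have := @coefB0_le3 R n n_gt0; have := @coefB_ge0 R n n_gt0 0.
rewrite /potential /=; set B := coefB n 0; set X := favg f x0 - _.
have : 0 <= X by rewrite subr_ge0.
set Z := vdot _ _ => X0 B0 B3 XZ /(ler_wpM2l (ltW L_gt0)) LZ.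
have := ler_wpM2r X0 B3; lra.
Qed.

Lemma coefG_ge k : (tauk R n k)^-2 <= 8 * L * coefG k.
Proof.
have t0 := @tauk_gt0 R n n_gt0 k; have t2 := @tauk_le R n n_gt0 k.
have -> : 8 * L * coefG k = 4 * (1 - tauk R n k) ^+ 2 * (tauk R n k)^-2.
  by rewrite /coefG; field; rewrite !lt0r_neq0.
rewrite -[leLHS]mul1r ler_wpM2r ?invr_ge0 ?sqr_ge0//; nra.
Qed.

Lemma coefG_ge0 k : 0 <= coefG k.
Proof.
by rewrite divr_ge0 ?sqr_ge0// mulr_ge0 ?sqr_ge0// mulr_ge0// ltW.
Qed.

Lemma E_fgap_le R0 x0 K : vnorm (x0 - xstar) <= R0 ->
  coefB n K * E_fgap L f g x0 xstar K <= 2 * (L * R0 ^+ 2).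
Proof.
move=> /potential0; apply: le_trans; apply: le_trans (potential_run K 0 (x0, x0)).
rewrite /E_fgap Expect_from -[favg f xstar](expect_from_cst n n_gt0 0 K).
rewrite -mulN1r -expect_fromZ -expect_fromD -expect_fromZ.
apply: ler_expect_from => s; rewrite mulN1r /xtilde /potential add0n.
rewrite addrCA lerDl addr_ge0//; last by rewrite mulr_ge0 ?vdot_ge0// divr_ge0// ltW.
by apply: sumr_ge0 => j _; rewrite mulr_ge0 ?coefG_ge0 ?vdot_ge0.
Qed.

Lemma E_sqr_grad_le R0 x0 K : vnorm (x0 - xstar) <= R0 ->
  expect_from n 0 K (fun s => \sum_(j < K) (tauk R n j)^-2 *
    vnorm (fullgrad g (xtilde L g x0 s j)) ^+ 2) <= 16 * L ^+ 2 * R0 ^+ 2.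
Proof.
move=> /potential0 V0.
have := le_trans (potential_run K 0 (x0, x0)) V0.
rewrite -(ler_pM2l (mulr_gt0 (ltr0Sn R 7) L_gt0)) -expect_fromZ => H.
rewrite (_ : 16 * _ * _ = 8 * L * (2 * (L * R0 ^+ 2))); last by ring.
apply: le_trans H; apply: ler_expect_from => s.
rewrite mulrDr; apply: ler_wpDr.
  rewrite mulr_ge0 ?mulr_ge0 ?(ltW L_gt0)// /potential addr_ge0//.
    by rewrite mulr_ge0 ?coefB_ge0 ?subr_ge0.
  by rewrite mulr_ge0 ?vdot_ge0// divr_ge0// ltW.
rewrite mulr_sumr; apply: ler_sum => j _.
by rewrite sqr_vnorm mulrA ler_wpM2r ?vdot_ge0 ?coefG_ge.
Qed.

(* Instead of Jensen's inequality: [2 a <= a ^ 2 / eps + eps]. *)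
Lemma E_grad_out_le R0 x0 K eps : (0 < K)%N -> 0 < eps ->
  vnorm (x0 - xstar) <= R0 ->
  16 * L ^+ 2 * R0 ^+ 2 <= eps ^+ 2 * \sum_(k < K) (tauk R n k)^-2 ->
  E_grad_out L g x0 K <= eps.
Proof.
move=> K0 e0 x0R0; set T := \sum_(k < K) _ => epsT.
have T0 : 0 < T.
  by apply: lt_le_trans (sum_tauk_invsq_ge4 n n_gt0 K); rewrite mulr_gt0 ?ltr0n.
rewrite /E_grad_out Expect_from.
(* Both summands equal [eps / 2]; the first makes room for the weighted sum of squared gradients. *)
have -> : eps = (2 * eps * T)^-1 * (eps ^+ 2 * T) + eps / 2.
  by field; rewrite !lt0r_neq0.
apply: le_trans (lerD (ler_wpM2l _ epsT) (lexx _)); last first.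
  by rewrite invr_ge0 !mulr_ge0// ltW.
apply: le_trans (lerD (ler_wpM2l _ (E_sqr_grad_le _ _ K x0R0)) (lexx _)); last first.
  by rewrite invr_ge0 !mulr_ge0// ltW.
rewrite -expect_fromZ -[eps / 2](expect_from_cst n n_gt0 0 K) -expect_fromD.
apply: ler_expect_from => s.
have -> : eps / 2 = \sum_(k < K) out_prob R n K k * (eps / 2).
  by rewrite -mulr_suml /out_prob -mulr_suml -/T divff ?lt0r_neq0// mul1r.
rewrite mulr_sumr -big_split; apply: ler_sum => k _ /=.
rewrite /out_prob -/T; set w := (tauk R n k)^-2; set a := vnorm _.
rewrite (_ : _ + _ = w / T * ((a ^+ 2 / eps + eps) / 2)); last first.
  by field; rewrite !lt0r_neq0.
apply: ler_wpM2l; first by rewrite divr_ge0 ?invr_ge0 ?sqr_ge0 ?ltW.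
rewrite -subr_ge0 (_ : _ - _ = (a - eps) ^+ 2 / (2 * eps)); last first.
  by field; rewrite lt0r_neq0.
by rewrite divr_ge0 ?sqr_ge0// mulr_ge0// ltW.
Qed.

End Potential.

(** * From iteration counts to oracle complexity *)

Section Complexity.
Context {R : realType}.
Implicit Types (q X a x : R) (n K : nat).

(** [E = expR m] satisfies [E >= 2] and [a <= E], so [16 (a^2 + 1) <= 32 E^2 <= E^7]. *)
Lemma ln_le_max1 a x : 0 <= a -> 0 < x -> x <= 16 * (a ^+ 2 + 1) ->
  ln x <= 7 * Num.max 1 (ln a).
Proof.
move=> a0 x0 xa; set m := Num.max _ _.
have e2 : 2 <= expR m.
  apply: le_trans (expR_ge1Dx m); rewrite lerD2l.
  by rewrite le_max lexx.
have am : a <= expR m.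
  have [a_le0|a_gt0] := leP a 0; first exact: le_trans a_le0 (expR_ge0 _).
  by rewrite -[leLHS]lnK ?posrE// ler_expR le_max lexx orbT.
rewrite -[leRHS]expRK ler_ln ?posrE ?expR_gt0//.
rewrite expRM_natl; apply: (le_trans xa).
move: (expR m) e2 am => E e2 am.
have : 32 <= E ^+ 5.
  have -> : 32 = 2 ^+ 5 :> R by rewrite -natrX.
  by rewrite lerXn2r// nnegrE//; lra.
have : a ^+ 2 + 1 <= 2 * E ^+ 2 by nra.
have -> : E ^+ 7 = E ^+ 5 * E ^+ 2 by rewrite -exprD.
have := sqr_ge0 E; nra.
Qed.

Lemma E_cost_le n K : (0 < n)%N ->
  E_cost R n K <=
  n%:R + 3 * K%:R + 6 * n%:R * ln (minn (K + 7) (6 * n))%:R.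
Proof.
move=> n_gt0; have n0 : 0 < n%:R :> R by rewrite ltr0n.
rewrite E_cost_eq//; have := ler_wpM2l (ltW n0) (sum_pk_le n n_gt0 K.-1).
rewrite (_ : n%:R * (_ + _) =
  K.-1%:R + 6 * (n%:R * ln (minn (K.-1 + 7) (6 * n))%:R)); last first.
  by field; rewrite lt0r_neq0.
have : ln (minn (K.-1 + 7) (6 * n))%:R <= ln (minn (K + 7) (6 * n))%:R :> R.
  rewrite ler_ln ?posrE ?ltr0n ?leq_min ?muln_gt0 ?n_gt0 ?addnS// ler_nat.
  rewrite leq_min geq_minr andbT (leq_trans (geq_minl _ _))//.
  by rewrite !ltnS leq_add2r leq_pred.
move=> /(fun h => ler_wpM2l (ltW n0) h).
have : K.-1%:R <= K%:R :> R by rewrite ler_nat leq_pred.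
by lra.
Qed.

(* [q] stands for [L R0 / eps] or [L R0 ^ 2 / eps]; the two disjuncts are the regimes
   in which [ln n], resp. [ln q], is the smaller logarithm up to a factor 2. *)
Lemma E_cost_order n K q X : (0 < n)%N -> 0 <= q -> 0 <= X ->
  K%:R <= 10 * X + 1 ->
  (n%:R <= q ^+ 2) || (q <= n%:R) && (K%:R + 7 <= 16 * (q ^+ 2 + 1)) ->
  E_cost R n K <= 90 * (n%:R * Num.max 1 (Num.min (ln q) (ln n%:R)) + X).
Proof.
move=> n_gt0 q0 X0 KX cases; have n1 : 1 <= n%:R :> R by rewrite ler1n.
have n0 : 0 < n%:R :> R by rewrite ltr0n.
apply: le_trans (E_cost_le n K n_gt0) _; set M := Num.max _ _.
have M1 : 1 <= M by rewrite le_max lexx.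
have min0 : 0 < (minn (K + 7) (6 * n))%:R :> R.
  by rewrite ltr0n leq_min muln_gt0 n_gt0 addnS.
(* In units of [n M], the cost beyond [30 X] is 1 for [n], 3 for rounding [K], and [6 * 14]: 88 in
   all. *)
suff lnM : ln (minn (K + 7) (6 * n))%:R <= 14 * M.
  have := ler_wpM2l (ltW n0) lnM; have := ler_wpM2l (ltW n0) M1; lra.
have lnn0 : 0 <= ln n%:R :> R by rewrite ln_ge0.
case/orP: cases => [nq|/andP[qn Kq]].
  have qgt0 : 0 < q by nra.
  have nq2 : ln n%:R <= 2 * ln q.
    by rewrite mulr_natl -lnXn// ler_ln ?posrE ?exprn_gt0//.
  have : ln (minn (K + 7) (6 * n))%:R <= 7 * Num.max 1 (ln n%:R) :> R.
    apply: ln_le_max1 => //.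
    apply: (@le_trans _ _ (6 * n)%:R); first by rewrite ler_nat geq_minr.
    by rewrite natrM; nra.
  move=> /le_trans; apply.
  suff : Num.max 1 (ln n%:R) <= 2 * M by lra.
  rewrite ge_max; apply/andP; split; first lra.
  apply: (@le_trans _ _ (2 * Num.min (ln q) (ln n%:R))).
    by rewrite /Num.min; case: ifP => _; lra.
  by rewrite ler_pM2l// le_max lexx orbT.
have -> : M = Num.max 1 (ln q).
  congr (Num.max _ _); apply/min_idPl.
  (* [q = 0] occurs when [R0 = 0]; there [ln] takes its default value 0. *)
  have [q_le0|qgt0] := leP q 0; first by rewrite ln0.
  by rewrite ler_ln ?posrE.
have : ln (minn (K + 7) (6 * n))%:R <= 7 * Num.max 1 (ln q).
  apply: ln_le_max1 => //.
  apply: (@le_trans _ _ (K + 7)%:R); first by rewrite ler_nat geq_minl.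
  by rewrite natrD.
have : 1 <= Num.max 1 (ln q) by rewrite le_max lexx.
by lra.
Qed.

Lemma powR_twothirds_cube x : 0 <= x -> (x `^ (2 / 3)) ^+ 3 = x ^+ 2.
Proof.
move=> x0; rewrite -powR_mulrn ?powR_ge0// -powRrM divfK//.
by rewrite powR_mulrn.
Qed.

(** The truncation plus one, rather than a ceiling, keeps [K] positive at [a = 0]. *)
Lemma exists_pos_nat_itv a : 0 <= a ->
  exists2 K : nat, (0 < K)%N & a <= K%:R <= a + 1.
Proof.
move=> /truncn_itv/andP[a1 a2]; exists (Num.truncn a).+1 => //.
by rewrite (ltW a2) -[_.+1%:R]natr1 lerD2r.
Qed.

End Complexity.

(** * Choice of the number of iterations *)

Theorem theorem4 (R : realType) :
  exists C : R, 0 < C /\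
  (forall (n : nat) (L R0 eps_g : R),
     (0 < n)%N -> 0 < L -> 0 <= R0 -> 0 < eps_g ->
     exists K : nat, (0 < K)%N /\
       E_cost R n K <= C * bound_g n L R0 eps_g /\
       forall (d : nat) (f : 'I_n -> 'rV[R]_d -> R)
              (g : 'I_n -> 'rV[R]_d -> 'rV[R]_d) (x0 xstar : 'rV[R]_d),
         (forall i, convex_fun (f i)) ->
         (forall i, is_gradient (f i) (g i)) ->
         (forall i, Lsmooth_grad (g i) L) ->
         (forall x, favg f xstar <= favg f x) ->
         vnorm (x0 - xstar) <= R0 ->
         E_grad_out L g x0 K <= eps_g) /\
  (forall (n : nat) (L R0 eps_f : R),
     (0 < n)%N -> 0 < L -> 0 <= R0 -> 0 < eps_f ->
     exists K : nat,
       E_cost R n K <= C * bound_f n L R0 eps_f /\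
       forall (d : nat) (f : 'I_n -> 'rV[R]_d -> R)
              (g : 'I_n -> 'rV[R]_d -> 'rV[R]_d) (x0 xstar : 'rV[R]_d),
         (forall i, convex_fun (f i)) ->
         (forall i, is_gradient (f i) (g i)) ->
         (forall i, Lsmooth_grad (g i) L) ->
         (forall x, favg f xstar <= favg f x) ->
         vnorm (x0 - xstar) <= R0 ->
         E_fgap L f g x0 xstar K <= eps_f).
Proof.
exists 90; split => //; split=> n L R0 eps n_gt0 L_gt0 R0_ge0 eps_gt0;
  have L_ge0 := ltW L_gt0; have eps_ge0 := ltW eps_gt0.
- have n1 : 1 <= n%:R :> R by rewrite ler1n.
  have n0 : 0 < n%:R :> R by rewrite ltr0n.
  pose q := L * R0 / eps.
  pose X := (n%:R * L * R0) `^ (2 / 3) / eps `^ (2 / 3).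
  have q0 : 0 <= q by rewrite divr_ge0 ?mulr_ge0 ?sqr_ge0.
  have X0 : 0 <= X by rewrite divr_ge0 ?powR_ge0.
  have X3 : X ^+ 3 = n%:R ^+ 2 * q ^+ 2.
    rewrite /X exprMn exprVn !powR_twothirds_cube ?mulr_ge0//.
    by rewrite /q; field; rewrite lt0r_neq0.
  (* Compare cubes: [q^6 <= n^2 q^2 = X^3]. *)
  have qX : q ^+ 2 <= n%:R -> q ^+ 2 <= X.
    move=> qn; rewrite -(@ler_pXn2r _ 3) ?nnegrE ?sqr_ge0// X3.
    by rewrite exprS mulrC ler_wpM2r ?sqr_ge0// lerXn2r ?nnegrE ?sqr_ge0 ?ler0n.
  (* The sum of [tauk^-2] must reach [16 q^2]: [4 K] does so in the first case; in the second,
     [K^3 / (27 n^2)] does, as [8^3 >= 27 * 16]. *)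
  pose c := if q ^+ 2 <= n%:R then 4 * q ^+ 2 else 8 * X.
  have c0 : 0 <= c by rewrite /c; case: ifP => _; rewrite mulr_ge0 ?sqr_ge0.
  have [K K_gt0 /andP[cK Kc]] := exists_pos_nat_itv c c0.
  exists K; split=> //; split.
    rewrite /bound_g -/q -/X; move: Kc; rewrite /c.
    case: ifPn => [qn|]; last rewrite -ltNge => qn; move=> Kc; apply: E_cost_order => //.
    + by have := qX qn; lra.
    + by apply/orP; right; apply/andP; split; nra.
    + by lra.
    + by rewrite ltW.
  move=> d f g x0 xstar f_convex f_grad f_smooth f_min x0R0.
  apply: (E_grad_out_le f g L xstar n_gt0 L_gt0 f_convex f_grad f_smooth f_min R0) => //.
  have -> : 16 * L ^+ 2 * R0 ^+ 2 = eps ^+ 2 * (16 * q ^+ 2).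
    by rewrite /q; field; rewrite lt0r_neq0.
  rewrite ler_wpM2l ?sqr_ge0//; move: cK; rewrite /c; case: ifPn => [qn|_] cK.
    by have := @sum_tauk_invsq_ge4 R n n_gt0 K; lra.
  apply: le_trans (sum_tauk_invsq_ge n n_gt0 K).
  rewrite ler_pdivlMr ?mulr_gt0 ?exprn_gt0//.
  have : (8 * X) ^+ 3 <= K%:R ^+ 3.
    by apply: lerXn2r; rewrite ?nnegrE// mulr_ge0.
  rewrite exprMn X3; have : 0 <= n%:R ^+ 2 * q ^+ 2 by rewrite mulr_ge0 ?sqr_ge0.
  by lra.
- have n1 : 1 <= n%:R :> R by rewrite ler1n.
  have n0 : 0 < n%:R :> R by rewrite ltr0n.
  pose q := L * R0 ^+ 2 / eps.
  pose X := Num.sqrt (n%:R * L) * R0 / Num.sqrt eps.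
  have q0 : 0 <= q by rewrite divr_ge0 ?mulr_ge0 ?sqr_ge0.
  have X0 : 0 <= X by rewrite divr_ge0 ?mulr_ge0 ?sqrtr_ge0.
  have X2 : X ^+ 2 = n%:R * q.
    rewrite /X !exprMn exprVn !sqr_sqrtr ?mulr_ge0//.
    by rewrite /q; ring.
  have qX : q <= n%:R -> q <= X.
    move=> qn; rewrite -(@ler_pXn2r _ 2) ?nnegrE// X2.
    by rewrite expr2 ler_wpM2r.
  (* [coefB n K] must reach [2 q]: the linear bound gives [50/24 q], the quadratic one
     [500/144 q]. *)
  pose c := if q <= n%:R then 10 * q else 10 * X.
  have c0 : 0 <= c by rewrite /c; case: ifP => _; rewrite mulr_ge0.
  have [K K_gt0 /andP[cK Kc]] := exists_pos_nat_itv c c0.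
  exists K; split.
    rewrite /bound_f -/q -/X; move: Kc; rewrite /c.
    case: ifPn => [qn|]; last rewrite -ltNge => qn; move=> Kc; apply: E_cost_order => //.
    + by have := qX qn; lra.
    + by apply/orP; right; rewrite qn /=; nra.
    (* From [q > n >= 1] follows [q^2 >= n]. *)
    + by apply/orP; left; nra.
  move=> d f g x0 xstar f_convex f_grad f_smooth f_min x0R0.
  have B0 : 0 < coefB n K :> R.
    apply: lt_le_trans (coefB_ge_early n n_gt0 K).
    by rewrite mulr_gt0// ?ltr0n// divr_gt0.
  rewrite -(ler_pM2l B0).
  apply: (le_trans (E_fgap_le f g L xstar n_gt0 L_gt0 f_convex f_grad f_smooth f_min
    R0 x0 K x0R0)).
  have -> : 2 * (L * R0 ^+ 2) = 2 * q * eps.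
    by rewrite /q; field; rewrite lt0r_neq0.
  rewrite ler_pM2r//; move: cK; rewrite /c; case: ifPn => [qn|_] cK.
    by have := @coefB_ge_early R n n_gt0 K; lra.
  apply: le_trans (coefB_ge_late n n_gt0 K).
  rewrite mulrA ler_pdivlMr//.
  have : (10 * X) ^+ 2 <= K%:R ^+ 2.
    by apply: lerXn2r; rewrite ?nnegrE// mulr_ge0.
  rewrite exprMn X2; have : 0 <= n%:R * q by rewrite mulr_ge0// ltW.
  by lra.
Qed.
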